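(* Let $Q=(Q_0,Q_1)$ be a finite quiver with no sinks such that every vertex is the target of arbitrarily long paths, and let $V=(V_a)_{a\in Q_0}$ be a tuple of nonempty, finite, pairwise disjoint sets. Let $\mathsf{EC}$ be the set of eventually constant set-valued representations of $Q$ on $V$, let $\overline{\mathbf V}=(|V_a|)_{a\in Q_0}$ and $\mathbf 1=(1)_{a\in Q_0}$, and let $N$ be the attaching cardinality matrix of $(Q,V)$. Then $$|\mathsf{EC}|=\overline{\mathbf V}!\,\bigl((I-N)^{-1}\bigr)_{\mathbf 1,\overline{\mathbf V}},$$ where $I$ is the identity matrix.
   Context: A quiver $Q=(Q_0,Q_1)$ is a directed multigraph (loops and parallel arrows allowed) with vertex set $Q_0$ and arrow set $Q_1$; each arrow $\alpha$ has a source $s(\alpha)$ and a target $t(\alpha)$. A path of length $\ell\ge 1$ is a sequence of arrows $\alpha_\ell\cdots\alpha_1$ with $t(\alpha_{i-1})=s(\alpha_i)$ for $i=2,\dots,\ell$; its source is $s(\alpha_1)$ and its target is $t(\alpha_\ell)$. A sink is a vertex with no outgoing arrow. A set-valued representation of $Q$ on $V=(V_a)_{a\in Q_0}$ is a tuple $W=(W_\alpha:V_{s(\alpha)}\to V_{t(\alpha)})_{\alpha\in Q_1}$ of functions. A transversal of $V$ is a subset $C\subseteq\overline V:=\coprod_{a\in Q_0}V_a$ that contains exactly one element of each $V_a$. The representation $W$ is eventually constant if there is a transversal $C$ such that for all sufficiently long paths $\alpha_\ell\cdots\alpha_1$ in $Q$ (i.e. all paths longer than some fixed length) the composition $W_{\alpha_\ell}\circ\cdots\circ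 W_{\alpha_1}$ maps into $C$. Equip $\mathbb N^{Q_0}$ (with $0\in\mathbb N$) with the pointwise partial order, and let $[\mathbf 0,\overline{\mathbf V}]=\prod_{a\in Q_0}\{0,1,\dots,|V_a|\}$. For $\mathbf c,\mathbf d\in\mathbb N^{Q_0}$ put $\mathbf c^{\mathbf d}=\prod_{a}c_a^{d_a}$ (with $0^0=1$), $\mathbf c!=\prod_a c_a!$, $|\mathbf c|=\sum_a c_a$. The adjacency matrix $\mathsf A(Q)\in\mathbb Z^{Q_0\times Q_0}$ has entry $\mathsf A(Q)_{b,a}$ equal to the number of arrows from $a$ to $b$. The attaching cardinality matrix $N$ is the rational matrix with rows and columns indexed by $[\mathbf 0,\overline{\mathbf V}]$ given by $$N_{\mathbf c,\mathbf d}=\frac{(-1)^{|\mathbf d-\mathbf c|-1}}{(\mathbf d-\mathbf c)!}\,\mathbf c^{\,\mathsf A(Q)(\mathbf d-\mathbf c)}\ \text{ if }\mathbf c<\mathbf d,\qquad N_{\mathbf c,\mathbf d}=0\ \text{ otherwise.}$$ It is strictly upper triangular with respect to the partial order, so $I-N$ is invertible. *)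

(* Defs.v *)
From mathcomp Require Import all_boot all_order all_algebra.
From mathcomp Require Import boolp.
Set Implicit Arguments.
Unset Strict Implicit.
Unset Printing Implicit Defensive.
Import GRing.Theory.

Record quiver := Quiver {
  Q0 : finType;
  Q1 : finType;
  src : Q1 -> Q0;
  tgt : Q1 -> Q0 }.
Arguments src {q} _.
Arguments tgt {q} _.

(* Paths have length at least 1. [PathSnoc p al] traverses p first and al
   last; in the notation al_l ... al_1 the arrow al is the leftmost one. *)
Inductive qpath (Q : quiver) : Q0 Q -> Q0 Q -> Type :=
| PathArrow (al : Q1 Q) : qpath (src al) (tgt al)
| PathSnoc (a : Q0 Q) (al : Q1 Q) (p : qpath a (src al)) : qpath a (tgt al).

Fixpoint qpath_length (Q : quiver) (a b : Q0 Q) (p : qpath a b) : nat :=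
  match p with
  | PathArrow _ => 1
  | PathSnoc _ _ p' => (qpath_length p').+1
  end.

Definition sink (Q : quiver) (a : Q0 Q) : Prop :=
  forall al : Q1 Q, src al <> a.

Definition target_of_long_paths (Q : quiver) (b : Q0 Q) : Prop :=
  forall l : nat, exists (a : Q0 Q) (p : qpath a b), l <= qpath_length p.

(* The vertex sets are a family of finite types, so they are disjoint as parts
   of the coproduct {a : Q0 Q & V a}. *)
Definition set_rep (Q : quiver) (V : Q0 Q -> finType) : finType :=
  {dffun forall al : Q1 Q, {ffun V (src al) -> V (tgt al)}}.

Fixpoint rep_path (Q : quiver) (V : Q0 Q -> finType) (W : set_rep V)
    (a b : Q0 Q) (p : qpath a b) : V a -> V b :=
  match p in qpath a' b' return V a' -> V b' with
  | PathArrow al => fun x => W al x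
  | PathSnoc _ al p' => fun x => W al (rep_path W p' x)
  end.

Definition transversal_of (Q : quiver) (V : Q0 Q -> finType)
    (C : {set {a : Q0 Q & V a}}) : Prop :=
  forall a : Q0 Q, exists! x : V a, Tagged V x \in C.

Definition eventually_constant (Q : quiver) (V : Q0 Q -> finType)
    (W : set_rep V) : Prop :=
  exists2 C : {set {a : Q0 Q & V a}}, transversal_of C &
    exists l : nat, forall (a b : Q0 Q) (p : qpath a b), l < qpath_length p ->
      forall x : V a, Tagged V (rep_path W p x) \in C.

Definition EC (Q : quiver) (V : Q0 Q -> finType) : {set set_rep V} :=
  [set W | `[< eventually_constant W >]].

Definition vle (I : finType) (c d : I -> nat) : bool := [forall a, c a <= d a].

Definition vlt (I : finType) (c d : I -> nat) : bool :=
  vle c d && [exists a, c a != d a].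

(* Subtraction is truncated; vsub d c is only used when vle c d holds. *)
Definition vsub (I : finType) (d c : I -> nat) : I -> nat :=
  fun a => d a - c a.

Definition vsize (I : finType) (c : I -> nat) : nat := \sum_a c a.

Definition vfact (I : finType) (c : I -> nat) : nat := \prod_a (c a)`!.

Definition vexp (I : finType) (c d : I -> nat) : nat := \prod_a c a ^ d a.

Definition adjacency (Q : quiver) (b a : Q0 Q) : nat :=
  #|[set al : Q1 Q | (src al == a) && (tgt al == b)]|.

Definition adjacency_mul (Q : quiver) (e : Q0 Q -> nat) : Q0 Q -> nat :=
  fun b => \sum_a adjacency b a * e a.

(* The box [0, n] in N^I. *)
Definition box (I : finType) (n : I -> nat) : finType :=
  {dffun forall a : I, 'I_(n a).+1}.

Definition box_val (I : finType) (n : I -> nat) (c : box n) : I -> nat :=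
  fun a => c a.

(* inord truncates: the value at a is 1 only when 0 < n a. *)
Definition box_one (I : finType) (n : I -> nat) : box n :=
  [ffun a => (inord 1 : 'I_(n a).+1)].

Definition box_top (I : finType) (n : I -> nat) : box n :=
  [ffun a => (ord_max : 'I_(n a).+1)].

Definition cardv (Q : quiver) (V : Q0 Q -> finType) : Q0 Q -> nat :=
  fun a => #|V a|.

Local Open Scope ring_scope.

Definition attaching_entry (Q : quiver) (c d : Q0 Q -> nat) : rat :=
  if vlt c d then
    (-1) ^+ (vsize (vsub d c)).-1 / (vfact (vsub d c))%:R
      * (vexp c (adjacency_mul (vsub d c)))%:R
  else 0.

(* Rows and columns are indexed by the box through its enumeration. The matrix is
   strictly triangular for the pointwise order, so 1%:M - attaching_matrix V is
   a unit and invmx gives its actual inverse. *)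
Definition attaching_matrix (Q : quiver) (V : Q0 Q -> finType) :
    'M[rat]_#|box (cardv V)| :=
  \matrix_(i, j) attaching_entry (box_val (enum_val i)) (box_val (enum_val j)).

(* Main.v *)
Require Import Defs.
From mathcomp Require Import all_boot all_order all_algebra.
From mathcomp Require Import ring boolp.
Set Implicit Arguments.
Unset Strict Implicit.
Unset Printing Implicit Defensive.
Import GRing.Theory Num.Theory.

(** The idea is to build an eventually constant representation by attaching
    leaves, and to count by inclusion-exclusion over the set of leaves.

    Let W be eventually constant on a subfamily S of V, and call a point of S a
    leaf if it is not the value of any W al at a point of S. If S has no leaf,
    then S equals its image under all paths of length k, for every k, hence S is
    a transversal; conversely a transversal has no leaf, because every vertex is
    the target of an arrow ([ec_on_leafless]). For T inside S, the eventually
    constant W on S for which all points of T are leaves are exactly the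
    eventually constant representations on X = S \ T extended by arbitrary maps
    from T into X ([ec_on_remove]); with c and d the size vectors of X and S
    there are c ^ (A(Q)(d - c)) such extensions ([vexp_adjacency]). Since the
    signs (-1)^(|T|-1) over the nonempty subsets T of a nonempty set add up to 1,
    the number e(S) of eventually constant representations on S satisfies

      e(S) = [S is a transversal]
             + sum over X strictly inside S of
                 (-1)^(|S \ X| - 1) * e(X) * c ^ (A(Q)(d - c)),

    which is [ec_count_recurrence]. There are prod_a binom(d_a, c_a) subfamilies
    X of S with size vector c, and binom(d_a, c_a) * c_a! / d_a! equals
    1 / (d_a - c_a)!, so e(S) / d! obeys the recurrence r = e_1 + r N, which
    characterizes the row of index 1 of the inverse of I - N
    ([inverse_row_recurrence], [ec_countE]). The theorem is the case S = V.

    Representations on a subfamily S are handled as total representations on V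
    of which only the values on S matter. The number e(S) is then a proportion
    of all representations, suitably rescaled ([ec_count]), and the freedom to
    choose the values on T independently of those on X becomes an independence
    statement about sets of functions ([card_independent]). *)

(** * Images of subfamilies under one step *)

Section Images.
Variables (Q : quiver) (V : Q0 Q -> finType).
Local Notation point := {a : Q0 Q & V a}.
Implicit Types (W : set_rep V) (X Y S T : {set point}).

Definition fiber X a : {set V a} := [set x | Tagged V x \in X].
Definition dimvec X (a : Q0 Q) : nat := #|fiber X a|.

Definition meets X := [forall a, 0 < dimvec X a].
Definition transv X := [forall a, dimvec X a == 1].

Definition step W X : {set point} :=
  [set y | [exists al, exists x : V (src al),
     (Tagged V x \in X) && (y == Tagged V (W al x))]].

Lemma stepP W X y :
  reflect (exists al (x : V (src al)), Tagged V x \in X /\ y = Tagged V (W al x))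
          (y \in step W X).
Proof.
rewrite inE; apply: (iffP existsP) => [[al /existsP[x /andP[xX /eqP ->]]]|].
  by exists al, x.
by case=> al [x [xX ->]]; exists al; apply/existsP; exists x; rewrite xX eqxx.
Qed.

Lemma mem_step W X al (x : V (src al)) :
  Tagged V x \in X -> Tagged V (W al x) \in step W X.
Proof. by move=> xX; apply/stepP; exists al, x. Qed.

Lemma stepS W X Y : X \subset Y -> step W X \subset step W Y.
Proof.
move=> /subsetP XY; apply/subsetP => y /stepP[al [x [xX ->]]].
exact/mem_step/XY.
Qed.

Lemma stepU W X Y : step W (X :|: Y) = step W X :|: step W Y.
Proof.
apply/eqP; rewrite eqEsubset; apply/andP; split; last first.
  by rewrite subUset (stepS _ (subsetUl X Y)) (stepS _ (subsetUr X Y)).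
apply/subsetP => y /stepP[al [x [+ ->]]]; rewrite !in_setU.
by case/orP => /(mem_step W) ->; rewrite ?orbT.
Qed.

Lemma iter_stepS W k X Y :
  X \subset Y -> iter k (step W) X \subset iter k (step W) Y.
Proof. by move=> XY; elim: k => //= k; exact: stepS. Qed.

(** On an invariant subfamily the iterated images decrease, so a condition
    on all sufficiently long paths becomes a condition on one of these images. *)
Lemma iter_step_sub W X j k :
  step W X \subset X -> j <= k -> iter k (step W) X \subset iter j (step W) X.
Proof.
move=> WX /subnK <-; elim: (k - j) => //= n IH; apply: subset_trans IH.
by rewrite -iterS iterSr; apply: iter_stepS.
Qed.

Lemma dimvecS X Y a : X \subset Y -> dimvec X a <= dimvec Y a.
Proof.
by move=> /subsetP XY; apply/subset_leq_card/subsetP => x; rewrite !inE => /XY.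
Qed.

Lemma dimvec_gt0 X a : reflect (exists x : V a, Tagged V x \in X) (0 < dimvec X a).
Proof.
by apply: (iffP card_gt0P) => -[x]; [rewrite inE|] => xX; exists x; rewrite ?inE.
Qed.

Lemma fiber_eq X Y : (forall a, fiber X a = fiber Y a) -> X = Y.
Proof.
move=> XY; apply/setP => -[a x].
by have /setP/(_ x) := XY a; rewrite !inE.
Qed.

Lemma fiber_sub X Y : X \subset Y <-> forall a, fiber X a \subset fiber Y a.
Proof.
split=> [/subsetP XY a|XY]; first by apply/subsetP=> x; rewrite !inE => /XY.
by apply/subsetP=> -[a x] xX; have /subsetP/(_ x) := XY a; rewrite !inE; apply.
Qed.

Lemma transv_meets X : transv X -> meets X.
Proof. by move=> /forallP tX; apply/forallP=> a; rewrite (eqP (tX a)). Qed.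

Lemma meets_sub_transv X Y : X \subset Y -> meets X -> transv Y -> X = Y.
Proof.
move=> XY /forallP mX /forallP tY; apply: fiber_eq => a; apply/eqP.
rewrite eqEcard (fiber_sub X Y).1 //=.
by rewrite -/(dimvec Y a) (eqP (tY a)); exact: mX.
Qed.

Lemma transv_sub X Y : X \subset Y -> meets X -> transv Y -> transv X.
Proof. by move=> XY mX tY; rewrite (meets_sub_transv XY mX tY). Qed.

Hypothesis in_arrow : forall a : Q0 Q, exists al : Q1 Q, tgt al = a.

Lemma step_meets W X : meets X -> meets (step W X).
Proof.
move=> /forallP mX; apply/forallP => a; apply/dimvec_gt0.
have [al <-] := in_arrow a; have /dimvec_gt0[x xX] := mX (src al).
by exists (W al x); exact: mem_step.
Qed.

Lemma iter_step_meets W k X : meets X -> meets (iter k (step W) X).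
Proof. by move=> mX; elim: k => //= k; exact: step_meets. Qed.

(** Eventual constancy of the restriction of W to an invariant subfamily S: the
    values at the points of S of all compositions along paths of length k form a
    transversal. On the whole family this agrees with the definition by paths
    when every V a is nonempty and every vertex has an incoming arrow, see
    [eventually_constantP]. *)
Definition ec_on W S :=
  (step W S \subset S) && `[< exists k, transv (iter k (step W) S) >].

Lemma ec_onP W S :
  reflect (step W S \subset S /\ exists k, transv (iter k (step W) S)) (ec_on W S).
Proof.
apply: (iffP andP) => -[WS]; last by move=> kS; split=> //; apply/asboolP.
by move=> /asboolP.
Qed.

Lemma ec_on_meets W S : ec_on W S -> meets S.
Proof.
move=> /ec_onP[WS [k tk]]; have /transv_meets/forallP mk := tk.
apply/forallP => a; apply: leq_trans (mk a) (dimvecS _ _).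
exact: (iter_step_sub WS (leq0n k)).
Qed.

(** If W has no leaf on S, then S is equal to all of its iterated images, and one
    of these is a transversal. Conversely the image of a transversal S meets every
    vertex and lies in S, so it is S. *)
Lemma ec_on_leafless W S : ec_on W S -> (S \subset step W S) = transv S.
Proof.
move=> ecS; have /ec_onP[WS [k tk]] := ecS.
apply/idP/idP => [SW|tS].
  have eS : step W S = S by apply/eqP; rewrite eqEsubset WS.
  suff eq_k : iter k (step W) S = S by rewrite eq_k in tk.
  by elim: k {tk} => //= k ->.
by rewrite (meets_sub_transv WS _ tS) // step_meets // transv_meets.
Qed.

(** Leaves are not in any image, so removing them keeps W eventually
    constant; attaching points by any map into what is left restores it, as all
    values then lie in S minus T. In both directions the two
    chains of iterated images interleave. *)
Lemma ec_on_remove W S T : T \subset S ->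
  ec_on W S && [disjoint T & step W S] =
  ec_on W (S :\: T) && (step W T \subset S :\: T).
Proof.
move=> TS; have DS : S :\: T \subset S by exact: subsetDl.
apply/andP/andP => -[].
  move=> /ec_onP[WS [k tk]] dT.
  have WD : step W S \subset S :\: T.
    by rewrite subsetD WS disjoint_sym.
  split; last exact: subset_trans (stepS _ TS) WD.
  apply/ec_onP; split; first exact: subset_trans (stepS _ DS) WD.
  exists k; apply: transv_sub (tk); first exact: iter_stepS.
  have /forallP mk : meets (iter k.+1 (step W) S).
    by apply: step_meets (transv_meets tk).
  apply/forallP => a; apply: leq_trans (mk a) (dimvecS _ _).
  by rewrite iterSr iter_stepS.
move=> ecD WT; have /ec_onP[WD [k tk]] := ecD.
have WS : step W S \subset S :\: T.
  by rewrite -{1}(setID S T) (setIidPr TS) stepU subUset WT.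
split; last by rewrite disjoint_sym; move: WS; rewrite subsetD => /andP[].
apply/ec_onP; split; first exact: subset_trans DS.
exists k.+1; apply: transv_sub (tk); first by rewrite iterSr iter_stepS.
apply: iter_step_meets; have /forallP mD := ec_on_meets ecD.
by apply/forallP => a; apply: leq_trans (mD a) (dimvecS _ _).
Qed.

Lemma eq_step W W' X :
  (forall al (x : V (src al)), Tagged V x \in X -> W al x = W' al x) ->
  step W X = step W' X.
Proof.
move=> eWW; apply/setP=> y; apply/stepP/stepP => -[al [x [xX ->]]]; exists al, x.
  by rewrite eWW.
by rewrite eWW.
Qed.

Lemma eq_ec_on W W' S :
  (forall al (x : V (src al)), Tagged V x \in S -> W al x = W' al x) ->
  ec_on W S = ec_on W' S.
Proof.
move=> eWW; rewrite /ec_on (eq_step eWW).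
have [WS|//] := boolP (step W' S \subset S).
have e k : iter k (step W) S = iter k (step W') S.
  elim: k => //= k ->; apply: eq_step => al x xk; apply: eWW.
  exact: subsetP (iter_step_sub WS (leq0n k)) _ xk.
by congr asbool; apply/propext; split=> -[k tk]; exists k; rewrite ?e // -e.
Qed.

End Images.

Section Paths.
Variables (Q : quiver) (V : Q0 Q -> finType).
Implicit Types (W : set_rep V).

Lemma rep_path_step W a b (p : qpath a b) (x : V a) :
  Tagged V (rep_path W p x) \in iter (qpath_length p) (step W) setT.
Proof.
by elim: p x => [al|c al p IH] x /=; apply: mem_step; rewrite ?inE.
Qed.

Lemma target_in_arrow (b : Q0 Q) :
  target_of_long_paths b -> exists al : Q1 Q, tgt al = b.
Proof.
by move=> /(_ 0)[a [p _]]; case: b / p => [al|c al p]; exists al.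
Qed.

Lemma step_rep_path W k y : y \in iter k.+1 (step W) setT ->
  exists a b (p : qpath a b) (x : V a),
    qpath_length p = k.+1 /\ y = Tagged V (rep_path W p x).
Proof.
elim: k y => [|k IH] y /stepP[al [x [xX ->]]].
  by exists (src al), (tgt al), (PathArrow al), x.
have [a [b [p [z [lp ex]]]]] := IH _ xX.
have eb : b = src al by have := congr1 tag ex.
move: p z lp ex; rewrite eb => p z lp ex.
exists a, (tgt al), (PathSnoc p), z; split=> /=; first by rewrite lp.
by move/eqP: ex; rewrite eq_Tagged /= => /eqP ->.
Qed.

(** A transversal C that catches all long paths contains an iterated image of the
    whole family, and this image meets every vertex, hence it is all of C. *)
Lemma eventually_constantP W :
  (forall a : Q0 Q, 0 < #|V a|) ->
  (forall a : Q0 Q, exists al : Q1 Q, tgt al = a) ->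
  eventually_constant W <-> ec_on W setT.
Proof.
move=> V0 in_arrow; split.
  case=> C tC [l Cl]; apply/ec_onP; split; first exact: subsetT.
  exists l.+1.
  apply: (@transv_sub _ _ _ C).
  - apply/subsetP => y /step_rep_path[a [b [p [x [lp ->]]]]].
    by apply: Cl; rewrite lp.
  - apply: (iter_step_meets in_arrow).
    apply/forallP => a; apply/dimvec_gt0.
    by have /card_gt0P[x _] := V0 a; exists x; rewrite inE.
  - apply/forallP => a; have [x [xC ux]] := tC a.
    apply/eqP/eqP/cards1P; exists x; apply/setP=> z; rewrite !inE.
    by apply/idP/eqP => [/ux|-> //].
case/ec_onP=> WT [k /forallP tk]; exists (iter k (step W) setT).
  move=> a; have /cards1P[x ex] := tk a; exists x; split.
    by have /setP/(_ x) := ex; rewrite !inE eqxx.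
  by move=> z zk; have /setP/(_ z) := ex; rewrite !inE zk => /esym/eqP.
exists k => a b p kp x.
apply: subsetP (rep_path_step W p x).
exact: iter_step_sub WT (ltnW kp).
Qed.

End Paths.

(** * Counting representations by their values on a subfamily *)

Section Counting.
Variables (Q : quiver) (V : Q0 Q -> finType).
Local Notation point := {a : Q0 Q & V a}.
Implicit Types (W : set_rep V) (X Y S T : {set point}).

Definition splice S W W' : set_rep V :=
  [ffun al => [ffun x => if Tagged V x \in S then W al x else W' al x]].

Lemma spliceE S W W' al (x : V (src al)) :
  splice S W W' al x = if Tagged V x \in S then W al x else W' al x.
Proof. by rewrite !ffunE. Qed.

(** If membership in A only depends on the values at points of S, and membership
    in B on the values elsewhere, then A and B are independent for the uniform
    distribution. Exchanging the values outside S within a pair (W, W') is an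
    involution that carries (A :&: B) * setT to A * B. *)
Lemma card_independent S (A B : {set set_rep V}) :
  (forall W W', (forall al (x : V (src al)), Tagged V x \in S ->
     W al x = W' al x) -> (W \in A) = (W' \in A)) ->
  (forall W W', (forall al (x : V (src al)), Tagged V x \notin S ->
     W al x = W' al x) -> (W \in B) = (W' \in B)) ->
  #|A :&: B| * #|set_rep V| = #|A| * #|B|.
Proof.
move=> AS BS; rewrite -[#|set_rep V|]cardsT -!cardsX.
pose swap (p : set_rep V * set_rep V) := (splice S p.1 p.2, splice S p.2 p.1).
have swapK : involutive swap.
  case=> W W'; congr pair; apply/ffunP => al; apply/ffunP => x;
    by rewrite /= !spliceE; case: ifP => xS; rewrite ?xS.
rewrite -(card_preimset _ (inv_inj swapK)); apply: eq_card => -[W W'].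
rewrite !inE /= andbT (AS _ W) ?(BS _ W') // => al x xS; rewrite spliceE.
  by rewrite (negPf xS).
by rewrite xS.
Qed.

(** The number of ways to map t new points, along all arrows, into points of
    multiplicity c; it is c ^ (A(Q) t), see [vexp_adjacency]. *)
Definition attach_count (c t : Q0 Q -> nat) : nat :=
  \prod_(al : Q1 Q) c (tgt al) ^ t (src al).

Lemma vexp_adjacency (c t : Q0 Q -> nat) :
  vexp c (adjacency_mul t) = attach_count c t.
Proof.
rewrite /attach_count (partition_big tgt xpredT) //=; apply: eq_bigr => b _.
rewrite /adjacency_mul expn_sum (partition_big src xpredT) //=.
apply: eq_bigr => a _.
rewrite (eq_bigr (fun=> c b ^ t a)) => [|al /andP[/eqP -> /eqP ->] //].
rewrite prod_nat_const -expnM mulnC; congr (_ ^ (_ * _)).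
by apply: eq_card => al; rewrite !inE andbC.
Qed.

Lemma prod_if_const (I : finType) (A : {set I}) (a b : nat) :
  (\prod_i if i \in A then a else b) * b ^ #|A| = a ^ #|A| * b ^ #|I|.
Proof.
rewrite big_if /= prod_nat_const -mulnA; congr (_ * _).
rewrite (eq_bigl (mem (~: A))) => [|i]; last by rewrite !inE.
by rewrite prod_nat_const -expnD addnC cardsC.
Qed.

(** The share of representations that send T into X, written without division:
    each value at a point of T is free in V and has to fall into X. *)
Lemma card_maps_into T X :
  #|[set W | step W T \subset X]| * attach_count (cardv V) (dimvec T) =
  #|set_rep V| * attach_count (dimvec X) (dimvec T).
Proof.
have -> : #|[set W | step W T \subset X]| = \prod_(al : Q1 Q)
    \prod_(x : V (src al))
      if x \in fiber T (src al) then dimvec X (tgt al) else #|V (tgt al)|.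
  pose F (al : Q1 Q) : pred {ffun V (src al) -> V (tgt al)} :=
    family (fun x => if x \in fiber T (src al) then mem (fiber X (tgt al))
                     else mem predT).
  rewrite (_ : #|_| = #|(family F : simpl_pred (set_rep V))|).
    rewrite card_family foldrE big_image; apply: eq_bigr => al _ /=.
    rewrite card_family foldrE big_image; apply: eq_bigr => x _ /=.
    by case: ifP.
  apply: eq_card => W; rewrite inE; apply/subsetP/familyP.
    move=> WX al; apply/familyP => x; case: ifP => // xT.
    by rewrite inE; apply: WX; apply: mem_step; rewrite inE in xT.
  move=> WF y /stepP[al [x [xT ->]]]; have /familyP/(_ x) := WF al.
  by rewrite !inE xT inE.
rewrite card_dep_ffun foldrE big_image /attach_count -!big_split /=.
apply: eq_bigr => al _; rewrite card_ffun prod_if_const mulnC //.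
Qed.

End Counting.

Local Open Scope ring_scope.

(** * Inclusion-exclusion over leaves *)

(** Expansion of the product of the factors 1 - [i in L]. *)
Lemma sum_sign_subsets (R : comNzRingType) (I : finType) (L : {set I}) :
  \sum_(T : {set I} | T \subset L) (-1) ^+ #|T| = (L == set0)%:R :> R.
Proof.
transitivity (\prod_i (- (i \in L)%:R + 1 : R)).
  rewrite bigA_distr big_mkcond /=; apply: eq_bigr => T _.
  rewrite -big_mkcond /= prodrN.
  case: ifP => [/subsetP TL|/negbT/subsetPn[i iT iL]].
    by rewrite big1 ?mulr1 // => i /TL ->.
  by rewrite (bigD1 i) //= (negPf iL) mul0r mulr0.
have [->|[i iL]] := set_0Vmem L.
  by rewrite eqxx big1 // => i _; rewrite in_set0 oppr0 add0r.
rewrite (bigD1 i) //= iL addNr mul0r; case: eqP => // L0.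
by rewrite L0 in_set0 in iL.
Qed.

Lemma sum_sign_nonempty_subsets (R : comNzRingType) (I : finType) (L : {set I}) :
  \sum_(T : {set I} | (T \subset L) && (T != set0)) (-1) ^+ #|T|.-1 =
  (L != set0)%:R :> R.
Proof.
have := sum_sign_subsets R L; rewrite (bigD1 set0) ?sub0set //= cards0 expr0.
rewrite (eq_bigr (fun T : {set I} => - (-1) ^+ #|T|.-1)) => [|T /andP[_]]; last first.
  by rewrite -card_gt0 => /prednK {1}<-; rewrite exprS mulN1r.
rewrite sumrN => /eqP; rewrite subr_eq addrC -subr_eq => /eqP <-.
by case: eqP => _; rewrite ?subrr ?subr0.
Qed.

Section Recurrence.
Variables (Q : quiver) (V : Q0 Q -> finType).
Local Notation point := {a : Q0 Q & V a}.
Implicit Types (W : set_rep V) (X Y S T : {set point}).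

Lemma card_dimvec X : #|X| = vsize (dimvec X).
Proof.
rewrite /vsize -sum1_card.
rewrite (eq_bigr (fun a => \sum_(x : V a | Tagged V x \in X) 1)%N) => [|a _].
  rewrite (sig_big_dep (op := addn) predT (fun a x => Tagged V x \in X)
             (fun a x => 1%N)) /=.
  by apply: eq_bigl => -[a x].
by rewrite sum1_card; apply: eq_card => x; rewrite !inE.
Qed.

Lemma dimvecD S X : X \subset S -> dimvec (S :\: X) = vsub (dimvec S) (dimvec X).
Proof.
move=> XS; apply/funext => a; rewrite /vsub /dimvec.
have -> : fiber (S :\: X) a = fiber S a :\: fiber X a.
  by apply/setP => x; rewrite !inE.
rewrite cardsD; congr (_ - #|pred_of_set _|)%N; apply/setIidPr.
exact: (fiber_sub X S).1.
Qed.

Lemma attach_count_split (c : Q0 Q -> nat) S X : X \subset S ->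
  (attach_count c (dimvec S) =
   attach_count c (dimvec X) * attach_count c (dimvec (S :\: X)))%N.
Proof.
move=> XS; rewrite /attach_count -big_split /=; apply: eq_bigr => al _.
by rewrite -expnD dimvecD // /vsub subnKC // dimvecS.
Qed.

Definition ec_set S : {set set_rep V} := [set W | ec_on W S].

(** The number of eventually constant representations on S itself: of the values
    of a total representation, those outside S are free, so the count on V is
    rescaled by the number of choices for the values on S over the number of all
    representations. *)
Definition ec_count S : rat :=
  #|ec_set S|%:R * (attach_count (cardv V) (dimvec S))%:R / #|set_rep V|%:R.

Hypothesis in_arrow : forall a : Q0 Q, exists al : Q1 Q, tgt al = a.
Hypothesis V_nonempty : forall a : Q0 Q, (0 < #|V a|)%N.

Lemma set_rep_gt0 : (0 < #|set_rep V|)%N.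
Proof.
pose pt a : V a := enum_val (Ordinal (V_nonempty a)).
by apply/card_gt0P; exists [ffun al => [ffun _ => pt (tgt al)]].
Qed.

Lemma ec_count_transv S : transv S -> ec_count S = 1.
Proof.
move=> tS; rewrite /ec_count -natrM.
have -> : ec_set S = [set W | step W S \subset S].
  apply/setP => W; rewrite !inE; apply: andb_idr => _.
  by apply/asboolP; exists 0%N.
rewrite card_maps_into natrM mulrAC divff ?pnatr_eq0 -?lt0n ?set_rep_gt0 //.
rewrite mul1r /attach_count big1 // => al _.
by rewrite (eqP (forallP tS _)) exp1n.
Qed.

(** Eventual constancy on X only concerns the values on X, while attaching S
    minus X to X only concerns the other values. *)
Lemma card_ec_attach S X : X \subset S ->
  (#|ec_set X :&: [set W | step W (S :\: X) \subset X]| * #|set_rep V| =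
   #|ec_set X| * #|[set W : set_rep V | step W (S :\: X) \subset X]|)%N.
Proof.
move=> XS; apply: (@card_independent _ _ X) => W W' eWW; rewrite !inE.
  exact: eq_ec_on.
rewrite (@eq_step _ _ W W') // => al x; rewrite inE => /andP[xX _].
exact: eWW.
Qed.

(** An eventually constant W on S contributes to the sum the signed number of
    nonempty sets T of leaves, which is 1 if there is a leaf and 0 otherwise; it
    has no leaf exactly when S is a transversal. *)
Lemma ec_leaf_expansion S :
  #|ec_set S|%:R = (transv S)%:R * #|ec_set S|%:R +
    \sum_(T : {set point} | (T \subset S) && (T != set0)) (-1) ^+ #|T|.-1 *
      #|[set W | ec_on W S && [disjoint T & step W S]]|%:R :> rat.
Proof.
have cardE (A : {set set_rep V}) : #|A|%:R = \sum_W (W \in A)%:R :> rat.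
  by rewrite -sum1_card natr_sum big_mkcond; apply: eq_bigr => W _; case: ifP.
under eq_bigr => T _ do rewrite cardE mulr_sumr.
rewrite exchange_big /= !cardE mulr_sumr -big_split /=; apply: eq_bigr => W _.
rewrite inE; case ecW: (ec_on W S); last first.
  by rewrite mulr0 add0r big1 // => T _; rewrite inE ecW mulr0.
rewrite (eq_bigr (fun T : {set point} => if [disjoint T & step W S] then
   (-1) ^+ #|T|.-1 else 0)); last first.
  by move=> T _; rewrite inE ecW; case: ifP; rewrite ?mulr1 ?mulr0.
rewrite -big_mkcondr /=.
rewrite (eq_bigl (fun T : {set point} => (T \subset S :\: step W S) && (T != set0))).
  rewrite sum_sign_nonempty_subsets setD_eq0 (ec_on_leafless in_arrow ecW).
  by case: transv; rewrite mulr1.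
by move=> T; rewrite subsetD andbAC.
Qed.

(** The leaf expansion, summed over the complement X of T in S: by independence
    the term of X is the product of the count on X and the number of attaching
    maps from S minus X to X. *)
Lemma ec_count_recurrence S :
  ec_count S = (transv S)%:R + \sum_(X : {set point} | X \proper S)
    (-1) ^+ (vsize (vsub (dimvec S) (dimvec X))).-1 * ec_count X *
      (vexp (dimvec X) (adjacency_mul (vsub (dimvec S) (dimvec X))))%:R.
Proof.
rewrite {1}/ec_count ec_leaf_expansion mulrDl mulrDl.
congr (_ + _).
  rewrite -!mulrA; have [tS|] := boolP (transv S); last by rewrite mul0r.
  by rewrite mul1r mulrA -/(ec_count S) ec_count_transv.
(* T is replaced by its complement X in S. *)
rewrite (reindex_onto (setD S) (setD S)) /=; last first.
  by move=> T /andP[TS _]; rewrite setDDr setDv set0U (setIidPr TS).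
rewrite 2!mulr_suml; apply: eq_big => X.
  rewrite subsetDl setD_eq0 setDDr setDv set0U properE andbC /=.
  by congr (_ && _); apply/eqP/setIidPr.
move=> /andP[_ /eqP].
rewrite setDDr setDv set0U => /setIidPr XS.
rewrite vexp_adjacency -dimvecD // -card_dimvec.
have -> : [set W | ec_on W S && [disjoint S :\: X & step W S]] =
  ec_set X :&: [set W | step W (S :\: X) \subset X].
  apply/setP => W; rewrite !inE (ec_on_remove in_arrow) ?subsetDl //.
  by rewrite setDDr setDv set0U (setIidPr XS).
rewrite -!mulrA; congr (_ * _).
rewrite /ec_count (attach_count_split _ XS).
have all0 : #|set_rep V|%:R != 0 :> rat by rewrite pnatr_eq0 -lt0n set_rep_gt0.
have := congr1 (fun n => n%:R : rat) (card_ec_attach XS).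
have := congr1 (fun n => n%:R : rat) (card_maps_into (S :\: X) X).
rewrite /= !natrM.
set e := #|_ :&: _|%:R; set r := #|set_rep V|%:R in all0 *.
move=> /esym /(canRL (mulKf all0)) -> /(canRL (mulfK all0)) ->.
ring.
Qed.

End Recurrence.

(** * The inverse of I - N *)

Lemma vleP (I : finType) (c d : I -> nat) :
  reflect (forall a, (c a <= d a)%N) (vle c d).
Proof. exact: forallP. Qed.

Lemma vlt_vsize (I : finType) (c d : I -> nat) :
  vlt c d -> (vsize c < vsize d)%N.
Proof.
move=> /andP[/vleP cd /existsP[a ca]]; rewrite /vsize.
rewrite (bigD1 a) //= [ltnRHS](bigD1 a) //= -addSn leq_add //.
  by rewrite ltn_neqAle ca cd.
by apply: leq_sum => b _; exact: cd.
Qed.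

Lemma box_val_inj (I : finType) (n : I -> nat) : injective (@box_val I n).
Proof.
by move=> c d cd; apply/ffunP => a; apply: val_inj; have := congr1 (@^~ a) cd.
Qed.

Section Inverse.
Variables (Q : quiver) (V : Q0 Q -> finType).
Local Notation n := (cardv V).

(** A row vector v with v = v N vanishes by induction on the total size of the
    index, since N c d = 0 unless c < d. *)
Lemma attaching_unit : 1%:M - attaching_matrix V \in unitmx.
Proof.
rewrite -row_free_unit; apply: inj_row_free => v.
rewrite mulmxBr mulmx1 => /eqP; rewrite subr_eq0 => /eqP vN.
suff v0 m (d : 'I_#|box n|) : (vsize (box_val (enum_val d)) < m)%N -> v 0 d = 0.
  by apply/rowP => d; rewrite mxE; apply: v0 (ltnSn _).
elim: m d => // m IH d dm; rewrite vN mxE big1 // => c _.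
rewrite mxE /attaching_entry; case: ifP => [cd|]; last by rewrite mulr0.
by rewrite IH ?mul0r // (leq_trans (vlt_vsize cd)).
Qed.

Definition inverse_row (b d : box n) : rat :=
  invmx (1%:M - attaching_matrix V) (enum_rank b) (enum_rank d).

Lemma inverse_row_recurrence (b d : box n) :
  inverse_row b d = (d == b)%:R +
    \sum_(c : box n) inverse_row b c * attaching_entry (box_val c) (box_val d).
Proof.
have := mulVmx attaching_unit; rewrite mulmxBr mulmx1.
move/eqP; rewrite subr_eq => /eqP/matrixP/(_ (enum_rank b) (enum_rank d)).
rewrite /inverse_row => ->; rewrite !mxE (inj_eq enum_rank_inj) eq_sym.
congr (_ + _); rewrite (reindex enum_rank); last exact/onW_bij/enum_rank_bij.
by apply: eq_bigr => c _; rewrite mxE !enum_rankK.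
Qed.

End Inverse.

(** * Size vectors of subfamilies *)

Section Subfamilies.
Variables (Q : quiver) (V : Q0 Q -> finType).
Local Notation point := {a : Q0 Q & V a}.
Local Notation n := (cardv V).
Implicit Types (X S : {set point}).

Definition dimbox X : box n := [ffun a => inord (dimvec X a)].

Lemma dimboxE X : box_val (dimbox X) = dimvec X.
Proof.
by apply/funext => a; rewrite /box_val ffunE inordK // ltnS max_card.
Qed.

Lemma card_subsets_dimvec S (c : Q0 Q -> nat) :
  #|[set X : {set point} | (X \subset S) && [forall a, dimvec X a == c a]]| =
  \prod_a 'C(dimvec S a, c a).
Proof.
(* A subfamily is the same as an independent choice of one subset per vertex. *)
pose F a : pred {set V a} := [pred Y : {set V a} | Y \subset fiber S a & #|Y| == c a].
pose fibers X : {dffun forall a, {set V a}} := [ffun a => fiber X a].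
have fibers_inj : injective fibers.
  move=> X Y /ffunP XY; apply: fiber_eq => a.
  by have := XY a; rewrite !ffunE.
rewrite -(card_imset _ fibers_inj).
transitivity #|(family F : simpl_pred {dffun forall a, {set V a}})|.
  apply: eq_card => f; apply/imsetP/familyP.
    move=> [X /[!inE] /andP[XS /forallP Xc] ->] a.
    by rewrite ffunE inE (fiber_sub X S).1 // [_ == _]Xc.
  move=> fF; pose X := [set p : point | tagged p \in f (tag p)].
  have fX a : fiber X a = f a by apply/setP => x; rewrite !inE.
  exists X; last by apply/ffunP => a; rewrite ffunE fX.
  rewrite inE; apply/andP; split; last first.
    by apply/forallP => a; have /andP[_] := fF a; rewrite /dimvec fX.
  by apply/fiber_sub => a; rewrite fX; have /andP[] := fF a.
rewrite card_family foldrE big_image /=; apply: eq_bigr => a _.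
by rewrite -cards_draws; apply: eq_card => Y; rewrite !inE.
Qed.

Lemma properE_dimvec X S : (X \proper S) = (X \subset S) && vlt (dimvec X) (dimvec S).
Proof.
apply/idP/andP => [XS|[XS lt]]; last first.
  rewrite properE XS /=; apply: contraTN lt => SX.
  have -> : S = X by apply/eqP; rewrite eqEsubset SX.
  by apply/negP => /vlt_vsize; rewrite ltnn.
have sub := proper_sub XS; split=> //; apply/andP; split.
  by apply/vleP => a; exact: dimvecS.
apply: contraTT XS; rewrite negb_exists => /forallP eXS.
have e : vsize (dimvec X) = vsize (dimvec S).
  by apply: eq_bigr => a _; apply/eqP/negPn.
by rewrite properEcard !card_dimvec e ltnn andbF.
Qed.

Lemma card_proper_subsets_dimbox S (c : box n) :
  #|[set X : {set point} | (X \proper S) && (dimbox X == c)]| =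
  if vlt (box_val c) (dimvec S) then \prod_a 'C(dimvec S a, box_val c a) else 0.
Proof.
have dimP X : (dimbox X == c) = [forall a, dimvec X a == box_val c a].
  apply/eqP/forallP => [<- a|Xc]; first by rewrite dimboxE.
  by apply: box_val_inj; apply/funext => a; rewrite dimboxE; exact/eqP.
case: ifP => cS.
  rewrite -card_subsets_dimvec; apply: eq_card => X; rewrite !inE -dimP.
  rewrite properE_dimvec -andbA -dimboxE.
  by congr (_ && _); case: eqP => [->|]; rewrite ?andbF // cS.
apply/eqP; rewrite cards_eq0; apply/eqP/setP => X; rewrite !inE properE_dimvec.
by case: eqP => [Xc|]; rewrite ?andbF // -dimboxE Xc cS !andbF.
Qed.

Lemma transv_dimbox S : (forall a, 0 < #|V a|)%N ->
  (dimbox S == box_one n) = transv S.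
Proof.
move=> V0; have one a : box_val (box_one n) a = 1%N.
  by rewrite /box_val ffunE inordK // ltnS; exact: V0.
apply/eqP/forallP => [eS a|tS]; first by rewrite -dimboxE eS one.
by apply: box_val_inj; apply/funext => a; rewrite dimboxE one; exact/eqP.
Qed.

End Subfamilies.

(** * Solving the recurrence *)

Lemma vfact_gt0 (I : finType) (c : I -> nat) : (0 < vfact c)%N.
Proof. by apply: prodn_gt0 => a; exact: fact_gt0. Qed.

Lemma vfact_bin (I : finType) (c d : I -> nat) : vle c d ->
  (\prod_a 'C(d a, c a) * (vfact c * vfact (vsub d c)) = vfact d)%N.
Proof.
move=> /vleP cd; rewrite /vfact -!big_split /=; apply: eq_bigr => a _.
exact: bin_fact.
Qed.

Section Solution.
Variables (Q : quiver) (V : Q0 Q -> finType).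
Local Notation point := {a : Q0 Q & V a}.
Local Notation n := (cardv V).
Hypothesis in_arrow : forall a : Q0 Q, exists al : Q1 Q, tgt al = a.
Hypothesis V_nonempty : forall a : Q0 Q, (0 < #|V a|)%N.

(** Both sides obey the same recurrence: grouping the X strictly inside S by
    their size vector c turns the binomial coefficients and c! into the factor
    d! / (d - c)! of the matrix entry. *)
Lemma ec_countE (S : {set point}) :
  ec_count S = (vfact (dimvec S))%:R * inverse_row (box_one n) (dimbox S).
Proof.
have [m] := ubnP #|S|; elim: m S => // m IH S Sm.
rewrite ec_count_recurrence // inverse_row_recurrence mulrDr; congr (_ + _).
  rewrite transv_dimbox //; have [tS|] := boolP (transv S); last by rewrite mulr0.
  by rewrite /vfact big1 ?mulr1 // => a _; rewrite (eqP (forallP tS a)).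
pose s := dimvec S.
(* The term of X in the recurrence, which only depends on its size vector. *)
pose G (c : box n) : rat := (-1) ^+ (vsize (vsub s (box_val c))).-1 *
  ((vfact (box_val c))%:R * inverse_row (box_one n) c) *
  (vexp (box_val c) (adjacency_mul (vsub s (box_val c))))%:R.
transitivity (\sum_(X : {set point} | X \proper S) G (dimbox X)).
  apply: eq_bigr => X XS; rewrite /G dimboxE IH //.
  exact: leq_trans (proper_card XS) _.
rewrite (partition_big (@dimbox Q V) xpredT) //= mulr_sumr.
apply: eq_bigr => c _.
rewrite (eq_bigr (fun=> G c)) => [|X /andP[_ /eqP ->] //].
rewrite sumr_const -mulr_natr.
rewrite -(eq_card (A := [set X : {set point} | (X \proper S) && (dimbox X == c)]));
  last by move=> X; rewrite inE.
rewrite card_proper_subsets_dimbox dimboxE /attaching_entry -/s.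
case: ifP => [/andP[cs _]|_]; last by rewrite !mulr0.
rewrite -(vfact_bin cs) /G !natrM.
have : (vfact (vsub s (box_val c)))%:R != 0 :> rat.
  by rewrite pnatr_eq0 -lt0n vfact_gt0.
by move=> f0; field.
Qed.

Lemma ec_count_setT : ec_count (setT : {set point}) = #|ec_set (setT : {set point})|%:R.
Proof.
have dT : dimvec (setT : {set point}) = n.
  by apply/funext => a; apply: eq_card => x; rewrite !inE.
rewrite /ec_count dT.
have -> : attach_count n n = #|set_rep V|.
  rewrite card_dep_ffun foldrE big_image; apply: eq_bigr => al _ /=.
  by rewrite card_ffun.
by rewrite mulfK // pnatr_eq0 -lt0n set_rep_gt0.
Qed.

Lemma dimbox_setT : dimbox (setT : {set point}) = box_top n.
Proof.
apply: box_val_inj; rewrite dimboxE; apply/funext => a.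
by rewrite /box_val ffunE; apply: eq_card => x; rewrite !inE.
Qed.

End Solution.

Theorem theorem1p1 (Q : quiver) (V : Q0 Q -> finType)
  (no_sinks : forall a : Q0 Q, ~ sink a)
  (long_paths : forall a : Q0 Q, target_of_long_paths a)
  (V_nonempty : forall a : Q0 Q, (0 < #|V a|)%N) :
  (#|EC V|)%:R =
    (vfact (cardv V))%:R *
    (invmx (1%:M - attaching_matrix V))
      (enum_rank (box_one (cardv V))) (enum_rank (box_top (cardv V))) :> rat.
Proof.
have in_arrow a := target_in_arrow (long_paths a).
have -> : EC V = ec_set setT.
  apply/setP => W; rewrite !inE; apply/asboolP/idP;
  by move/(eventually_constantP W V_nonempty in_arrow).
rewrite -ec_count_setT // ec_countE // dimbox_setT.
congr (_%:R * _); rewrite /vfact; apply: eq_bigr => a _; congr (_`!).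
by apply: eq_card => x; rewrite !inE.
Qed.
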